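(* Let $\mathbf{b} = (b_1,b_2,b_3,b_4) \in \mathbb{C}^4$ and let $\mathcal{M}_{\mathbf b} = \mathrm{Spec}\big(\mathbb{C}[x_1,x_2,x_3]/(u_4(\mathbf b))\big)$ be the relative $\mathrm{SL}(2,\mathbb{C})$-representation variety of the four-holed sphere with boundary traces $\mathbf b$. Then $\mathcal{M}_{\mathbf b}$ is singular if and only if $\psi_4(\mathbf b) = 0$.
   Context: For $\mathbf{t}=(t_1,t_2,t_3,t_4)$ put $$u_4(\mathbf t) = 4-t_1^2-t_2^2-t_3^2-t_4^2-t_1t_2t_3t_4 + (t_1t_2+t_3t_4)x_1 + (t_1t_3+t_2t_4)x_2 + (t_2t_3+t_1t_4)x_3 - x_1^2-x_2^2-x_3^2 - x_1x_2x_3,$$ and $u_4(\mathbf b)\in\mathbb{C}[x_1,x_2,x_3]$ is its specialization at $\mathbf t=\mathbf b$. (Here the fundamental group is the free group on $F_1,F_2,F_3$, the punctures are $F_1,F_2,F_3,F_4=(F_1F_2F_3)^{-1}$, $t_i=\mathrm{tr}\,\rho(F_i)$, $x_1=\mathrm{tr}\,\rho(F_1F_2)$, $x_2=\mathrm{tr}\,\rho(F_1F_3)$, $x_3=\mathrm{tr}\,\rho(F_2F_3)$.) The polynomial $\psi_4 \in \mathbb{C}[y_1,y_2,y_3,y_4]$ is $$\psi_4(\mathbf y) = \Delta(\mathbf y)^2\prod_{i=1}^4 (y_i^2-4),$$ where $$\Delta(\mathbf y)= \sum_{i=1}^4 y_i^4 - 2\sum_{1\le i<j\le 4} y_i^2y_j^2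 + 8y_1y_2y_3y_4 + \sum_{1\le i<j<k\le 4} y_i^2y_j^2y_k^2 - y_1y_2y_3y_4\sum_{i=1}^4 y_i^2 = s_1^4 - 4s_1^2s_2 - s_1^2s_4 + 8s_1s_3 + s_3^2,$$ with $s_i$ the $i$-th elementary symmetric polynomial in $y_1,\dots,y_4$. For an ideal $I=(\phi_1,\dots,\phi_k)\subseteq \mathcal{O}=\mathbb{C}[x_1,\dots,x_n]$ of codimension $c$, $\mathrm{Spec}(\mathcal{O}/I)$ is smooth if and only if $I$ plus the ideal generated by the $c\times c$ minors of $[\partial\phi_i/\partial x_j]$ equals $\mathcal{O}$; singular means not smooth. *)

(* Defs.v *)
From HB Require Import structures.
From mathcomp Require Import all_boot all_order all_algebra.
From mathcomp Require Import mpoly.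

Set Implicit Arguments.
Unset Strict Implicit.
Unset Printing Implicit Defensive.

Import GRing.Theory.
Local Open Scope ring_scope.

Section Ideals.
Variable A : comNzRingType.

Definition ideal_gen (S : A -> Prop) (p : A) : Prop :=
  exists (m : nat) (a g : 'I_m -> A),
    (forall i, S (g i)) /\ p = \sum_(i < m) a i * g i.

(* [idealr_closed] already requires [1 \notin P]. *)
Definition prime_ideal (P : {pred A}) : Prop :=
  idealr_closed P /\ prime_idealr_closed P.

(* There is a chain Q 0 < Q 1 < ... < Q c = P of prime ideals. *)
Definition height_ge (P : {pred A}) (c : nat) : Prop :=
  exists Q : nat -> {pred A},
    [/\ forall i, (i <= c)%N -> prime_ideal (Q i),
        forall i, (i < c)%N ->
          {subset Q i <= Q i.+1} /\ ~ {subset Q i.+1 <= Q i}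
      & Q c =i P].

Definition prime_over (I : A -> Prop) (P : {pred A}) : Prop :=
  prime_ideal P /\ (forall p, I p -> p \in P).

(* The codimension of I is its height, the least height of a prime over I;
   the unit ideal has no codimension. *)
Definition has_codim (I : A -> Prop) (c : nat) : Prop :=
  (forall P, prime_over I P -> height_ge P c) /\
  (exists P, prime_over I P /\ ~ height_ge P c.+1).

End Ideals.

Section JacobianCriterion.
Variables (K : fieldType) (n k : nat).
Variable phi : 'I_k -> {mpoly K[n]}.

Definition gens (p : {mpoly K[n]}) : Prop := exists i, p = phi i.

Definition jacobian : 'M[{mpoly K[n]}]_(k, n) :=
  \matrix_(i < k, j < n) (phi i)^`M(j).

(* Arbitrary row and column selections f, g only add zeros and signed copies
   of the minors taken along increasing selections. *)
Definition minors (c : nat) (p : {mpoly K[n]}) : Prop :=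
  exists (f : 'I_c -> 'I_k) (g : 'I_c -> 'I_n),
    p = \det (mxsub f g jacobian).

(* Spec (K[x_1, ..., x_n] / (phi_1, ..., phi_k)) is smooth. When the phi_i
   generate the unit ideal there is no codimension c, and the empty scheme is
   smooth. *)
Definition smooth_Spec : Prop :=
  forall c : nat, has_codim (ideal_gen gens) c ->
    forall p, ideal_gen (fun q => gens q \/ minors c q) p.

Definition singular_Spec : Prop := ~ smooth_Spec.

End JacobianCriterion.

Section FourHoledSphere.
Variable K : fieldType.

(* u_4 as a polynomial in x_1, x_2, x_3 with coefficients in K[t_1, ..., t_4]. *)
Definition u4 : {mpoly {mpoly K[4]}[3]} :=
  let t1 := ('X_(@Ordinal 4 0 isT) : {mpoly K[4]})%:MP in
  let t2 := ('X_(@Ordinal 4 1 isT) : {mpoly K[4]})%:MP in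
  let t3 := ('X_(@Ordinal 4 2 isT) : {mpoly K[4]})%:MP in
  let t4 := ('X_(@Ordinal 4 3 isT) : {mpoly K[4]})%:MP in
  let x1 := 'X_(@Ordinal 3 0 isT) in
  let x2 := 'X_(@Ordinal 3 1 isT) in
  let x3 := 'X_(@Ordinal 3 2 isT) in
  4%:R - t1 ^+ 2 - t2 ^+ 2 - t3 ^+ 2 - t4 ^+ 2 - t1 * t2 * t3 * t4
  + (t1 * t2 + t3 * t4) * x1 + (t1 * t3 + t2 * t4) * x2
  + (t2 * t3 + t1 * t4) * x3
  - x1 ^+ 2 - x2 ^+ 2 - x3 ^+ 2 - x1 * x2 * x3.

Definition u4_at (b : 'I_4 -> K) : {mpoly K[3]} := map_mpoly (meval b) u4.

Definition Delta : {mpoly K[4]} :=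
  \sum_(i < 4) 'X_i ^+ 4
  - 2%:R * (\sum_(i < 4) \sum_(j < 4 | (i < j)%N) 'X_i ^+ 2 * 'X_j ^+ 2)
  + 8%:R * (\prod_(i < 4) 'X_i)
  + \sum_(i < 4) \sum_(j < 4 | (i < j)%N) \sum_(k < 4 | (j < k)%N)
      'X_i ^+ 2 * 'X_j ^+ 2 * 'X_k ^+ 2
  - (\prod_(i < 4) 'X_i) * (\sum_(i < 4) 'X_i ^+ 2).

Definition psi4 : {mpoly K[4]} :=
  Delta ^+ 2 * \prod_(i < 4) ('X_i ^+ 2 - 4%:R).

(* M_b = Spec (K[x_1, x_2, x_3] / (u_4(b))) is singular. *)
Definition M_singular (b : 'I_4 -> K) : Prop :=
  singular_Spec (fun _ : 'I_1 => u4_at b).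

End FourHoledSphere.

(* Main.v *)
Require Import Defs.
From HB Require Import structures.
From mathcomp Require Import all_boot all_order all_algebra.
From mathcomp Require Import complex reals mpoly.
From mathcomp Require Import ring.

(** Write (a, b, c, d) for the boundary traces and (x, y, z) for the
    coordinates. The proof has three independent parts.

    Codimension. Up to sign, u_4(b) is a monic quadratic in z. Its discriminant
    is a quadratic polynomial in y whose leading coefficient x^2 - 4 has a
    simple root, so it is not a square and u_4(b) is a prime element
    ([monic_quadratic_prime]). A prime element generates an ideal of height
    one ([has_codim_prime_element]), so the minors in the Jacobian criterion are
    the three partial derivatives.

    From ideals to points. Eliminating two variables between the partial
    derivatives leaves a quintic in the third ([partials_elim]), so the ideal J
    generated by u_4(b) and its partial derivatives contains a nonzero
    univariate polynomial in each variable. For such ideals the weak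
    Nullstellensatz is elementary ([finite_weak_nullstellensatz]): J is the unit
    ideal unless u_4(b) and its derivatives have a common zero.

    Singular points. Let kappa(a, b, x) = x^2 - a b x + a^2 + b^2 - 4, which is
    tr [A, B] - 2 for A, B of traces a, b with tr A B = x, and vanishes when A
    and B have a common eigenvector. Then Delta is the resultant in x of
    kappa(a, b, x) and kappa(c, d, x). At a singular point,
    kappa(a, b, x) kappa(c, d, x) = 0, and likewise for the two other ways of
    pairing the punctures ([sing_kappa12]). Choosing one vanishing factor for
    each gives three pairs of punctures that either share a puncture or form a
    triangle. The zeros of kappa are parametrized by eigenvalues s of A and t of
    B, as x = s t + (s t)^-1, and in these coordinates the critical point
    equations factor. Unless some boundary trace is 2 or -2, they imply that
    suitably chosen eigenvalues of the four boundary matrices multiply to 1, or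
    that all boundary traces are 0; Delta vanishes in both cases
    ([star_delta], [triangle_delta]). Conversely, such eigenvalues give the
    singular point of a diagonal representation ([delta_sing_point]), and a
    boundary trace 2 or -2 that of a representation with a central boundary
    matrix ([central_sing_point]). *)

Set Implicit Arguments.
Unset Strict Implicit.
Unset Printing Implicit Defensive.

Import GRing.Theory.
Local Open Scope ring_scope.

Local Notation t_ i := (@Ordinal 4 i isT).
Local Notation x_ i := (@Ordinal 3 i isT).

(** * Generated ideals *)

Section IdealGeneration.
Variable A : comNzRingType.
Implicit Types (S T : A -> Prop) (p q : A).

Lemma ideal_gen_sub S p : S p -> ideal_gen S p.
Proof.
by move=> Sp; exists 1%N, (fun=> 1), (fun=> p); rewrite big_ord1 mul1r.
Qed.

Lemma ideal_genD S p q : ideal_gen S p -> ideal_gen S q -> ideal_gen S (p + q).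
Proof.
move=> [m [a [g [Sg ->]]]] [n [b [h [Sh ->]]]].
pose pick (T : Type) (s : 'I_m -> T) (t : 'I_n -> T) (k : 'I_(m + n)) :=
  match split k with inl i => s i | inr j => t j end.
exists (m + n)%N, (pick _ a b), (pick _ g h); split=> [k|].
  by rewrite /pick; case: split.
rewrite big_split_ord /=; congr (_ + _); apply: eq_bigr => i _.
  by rewrite /pick -[lshift n i]/(unsplit (inl i)) unsplitK.
by rewrite /pick -[rshift m i]/(unsplit (inr i)) unsplitK.
Qed.

Lemma ideal_genMl S p q : ideal_gen S q -> ideal_gen S (p * q).
Proof.
move=> [m [a [g [Sg ->]]]]; exists m, (fun i => p * a i), g; split=> //.
by rewrite mulr_sumr; apply: eq_bigr => i _; rewrite mulrA.
Qed.

Lemma ideal_genMr S p q : ideal_gen S p -> ideal_gen S (p * q).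
Proof. by rewrite mulrC; apply: ideal_genMl. Qed.

Lemma ideal_genN S p : ideal_gen S p -> ideal_gen S (- p).
Proof. by rewrite -mulN1r; apply: ideal_genMl. Qed.

Lemma ideal_genB S p q : ideal_gen S p -> ideal_gen S q -> ideal_gen S (p - q).
Proof. by move=> Sp /ideal_genN; apply: ideal_genD. Qed.

Lemma ideal_gen0 S : ideal_gen S 0.
Proof. by exists 0%N, (fun=> 0), (fun=> 0); split; [case|rewrite big_ord0]. Qed.

Lemma ideal_gen_full S p : ideal_gen S 1 -> ideal_gen S p.
Proof. by move/(ideal_genMl p); rewrite mulr1. Qed.

Lemma ideal_gen_mono S T p :
  (forall q, S q -> ideal_gen T q) -> ideal_gen S p -> ideal_gen T p.
Proof.
move=> ST [m [a [g [Sg ->]]]]; elim/big_ind: _ => [||i _].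
- exact: ideal_gen0.
- by move=> x y; apply: ideal_genD.
- by apply: ideal_genMl; apply: ST.
Qed.

Lemma ideal_gen_vanish (B : comNzRingType) (f : {rmorphism A -> B}) S p :
  (forall q, S q -> f q = 0) -> ideal_gen S p -> f p = 0.
Proof.
move=> fS0 [m [a [g [Sg ->]]]]; rewrite rmorph_sum big1 // => i _.
by rewrite rmorphM /= (fS0 (g i)) ?mulr0.
Qed.

Definition adjoin S r : A -> Prop := fun p => S p \/ p = r.

Lemma ideal_gen_adjoinP S r p :
  ideal_gen (adjoin S r) p <-> exists a, ideal_gen S (p - a * r).
Proof.
split=> [[m [a [g [Sg ->]]]]|[a Sp]].
  elim/big_ind: _ => [|x y [c Sx] [d Sy]|i _].
  - by exists 0; rewrite mul0r subr0; apply: ideal_gen0.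
  - exists (c + d); rewrite mulrDl opprD addrACA; exact: ideal_genD.
  - case: (Sg i) => [Sgi|->].
      by exists 0; rewrite mul0r subr0; apply/ideal_genMl/ideal_gen_sub.
    by exists (a i); rewrite subrr; apply: ideal_gen0.
rewrite -(subrK (a * r) p); apply: ideal_genD.
  by apply: ideal_gen_mono Sp => q Sq; apply: ideal_gen_sub; left.
by apply/ideal_genMl/ideal_gen_sub; right.
Qed.

(** An ideal comaximal with each of finitely many elements is comaximal with
    their product, so it cannot contain that product unless it is the unit
    ideal. *)
Lemma comaximal_prod S (I : eqType) (rs : seq I) (F : I -> A) :
    ideal_gen S (\prod_(r <- rs) F r) ->
    (forall r, r \in rs -> ideal_gen (adjoin S (F r)) 1) ->
  ideal_gen S 1.
Proof.
move=> Sprod comax.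
suff [a Sa]: exists a, ideal_gen S (1 - a * \prod_(r <- rs) F r).
  by rewrite -(subrK (a * \prod_(r <- rs) F r) 1); apply/ideal_genD/ideal_genMl.
elim: rs comax {Sprod} => [|r rs IH] comax.
  by exists 1; rewrite big_nil mulr1 subrr; apply: ideal_gen0.
have [b Sb] := IH (fun s rs_s => comax s (@mem_behead _ (r :: rs) s rs_s)).
have /ideal_gen_adjoinP[a Sa] := comax r (mem_head _ _).
exists (a * b); rewrite big_cons.
have -> : 1 - a * b * (F r * \prod_(s <- rs) F s)
       = (1 - a * F r) + a * F r * (1 - b * \prod_(s <- rs) F s) by ring.
by apply: ideal_genD => //; apply: ideal_genMl.
Qed.

End IdealGeneration.

(** * A weak Nullstellensatz for finite quotients *)

Section MpolyMorphisms.
Variables (n : nat) (R : comNzRingType).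

Lemma mpoly_rmorph_eq (S : comNzRingType) (f g : {rmorphism {mpoly R[n]} -> S}) :
  (forall c, f c%:MP = g c%:MP) -> (forall i, f 'X_i = g 'X_i) -> f =1 g.
Proof.
move=> eqC eqX; elim/mpolyind => [|c m p _ _ IH]; first by rewrite !rmorph0.
rewrite !rmorphD -mul_mpolyC !rmorphM /= eqC IH mpolyXE_id !rmorph_prod /=.
by do 2![congr (_ + _)|congr (_ * _)]; apply: eq_bigr => i _;
  rewrite !rmorphXn /= eqX.
Qed.

(** Taylor expansion of p to order zero at v. *)
Lemma mpoly_sub_meval (v : 'I_n -> R) (T : {mpoly R[n]} -> Prop) p :
    (forall i, ideal_gen T ('X_i - (v i)%:MP)) ->
  ideal_gen T (p - (p.@[v])%:MP).
Proof.
move=> TX.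
have TM (q r : {mpoly R[n]}) : ideal_gen T (q - (q.@[v])%:MP) ->
    ideal_gen T (r - (r.@[v])%:MP) -> ideal_gen T (q * r - ((q * r).@[v])%:MP).
  move=> Tq Tr; rewrite mevalM mpolyCM.
  have -> : q * r - q.@[v]%:MP * r.@[v]%:MP
     = (q - q.@[v]%:MP) * r + q.@[v]%:MP * (r - r.@[v]%:MP) by ring.
  by apply: ideal_genD; [apply: ideal_genMr | apply: ideal_genMl].
have TC c : ideal_gen T (c%:MP - ((c%:MP_[n]).@[v])%:MP).
  by rewrite mevalC subrr; apply: ideal_gen0.
elim/mpolyind: p => [|c m p _ _ IH].
  by rewrite meval0 subrr; apply: ideal_gen0.
rewrite mevalD mpolyCD opprD addrACA; apply: ideal_genD => //.
rewrite -mul_mpolyC; apply: (TM) => //; rewrite mpolyXE_id.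
apply: (big_ind (fun q => ideal_gen T (q - (q.@[v])%:MP))) => [||i _].
  exact: TC 1.
  by move=> x y; apply: TM.
elim: (m i) => [|k IHk]; first exact: TC 1.
by rewrite exprS; apply: TM => //; rewrite mevalXU.
Qed.

End MpolyMorphisms.

(** Adjoining X_i - r for each variable X_i in turn, where r is a root of the
    given univariate polynomial, turns the ideal into that of a point, where
    some generator takes an invertible value. By comaximality, 1 then belongs
    to the ideal before each adjunction. *)
Lemma finite_weak_nullstellensatz (K : closedFieldType) (n : nat)
    (S : {mpoly K[n]} -> Prop) :
    (forall i, exists p : {poly K},
       p != 0 /\ ideal_gen S (map_poly (@mpolyC n K) p).['X_i]) ->
    (forall v, exists g, S g /\ g.@[v] != 0) ->
  ideal_gen S 1.
Proof.
move=> fin_S nozero.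
have splitS i : exists rs : seq K, ideal_gen S (\prod_(r <- rs) ('X_i - r%:MP)).
  have [p [p0 Sp]] := fin_S i; have [rs Dp] := closed_field_poly_normal p.
  exists rs; move: Sp; rewrite [in map_poly _ _]Dp map_polyZ rmorph_prod /=.
  rewrite hornerZ horner_prod => /(ideal_genMl (lead_coef p)^-1%:MP).
  rewrite mulrA -mpolyCM mulVf ?lead_coef_eq0 // mul1r.
  congr ideal_gen; apply: eq_bigr => r _.
  by rewrite rmorphB /= map_polyX map_polyC /= !hornerE.
pose T (s : seq 'I_n) (v : 'I_n -> K) p :=
  S p \/ exists i, i \notin s /\ p = 'X_i - (v i)%:MP.
have T1 s : forall v, ideal_gen (T s v) 1.
  elim: s => [|i s IH] v.
    have [g [Sg gv]] := nozero v.
    have Tg : ideal_gen (T [::] v) (g - g.@[v]%:MP).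
      by apply: mpoly_sub_meval => i; apply: ideal_gen_sub; right; exists i.
    have : ideal_gen (T [::] v) (g - (g - g.@[v]%:MP)).
      by apply: ideal_genB => //; apply: ideal_gen_sub; left.
    rewrite subKr => /(ideal_genMl (g.@[v])^-1%:MP).
    by rewrite -mpolyCM mulVf.
  have [rs Srs] := splitS i.
  apply: (@comaximal_prod _ _ _ rs (fun r => 'X_i - r%:MP)).
    by apply: ideal_gen_mono Srs => q Sq; apply: ideal_gen_sub; left.
  move=> r _; apply: ideal_gen_mono (IH (fun j => if j == i then r else v j)).
  move=> q [Sq|[j [sj ->]]]; apply: ideal_gen_sub; first by left; left.
  have [->|ji] := eqVneq j i; first by right.
  by left; right; exists j; rewrite inE negb_or ji.
apply: ideal_gen_mono (T1 (enum 'I_n) (fun=> 0)) => q [Sq|[i []]].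
  exact: ideal_gen_sub.
by rewrite mem_enum.
Qed.

(** * Primality of monic quadratics *)

(** Compare the multiplicities of r in the leading coefficients: they would
    have opposite parities. *)
Lemma lead_simple_root_nonsquare (K : fieldType) (D : {poly {poly K}})
    (r : K) (w : {poly K}) :
    lead_coef D = ('X - r%:P) * w -> ~~ root w r ->
  forall u v : {poly {poly K}}, u ^+ 2 = v ^+ 2 * D -> v = 0.
Proof.
move=> lcD rw u v; have [//|v0] := eqVneq v 0.
have w0 : w != 0 by apply: contraNneq rw => ->; rewrite root0.
have X0 := polyXsubC_eq0 r.
have D0 : D != 0 by rewrite -lead_coef_eq0 lcD mulf_neq0 ?X0.
have [->|u0] := eqVneq u 0.
  by move/esym/eqP; rewrite expr0n mulf_eq0 (negPf D0) orbF sqrf_eq0 => /eqP.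
move/(congr1 (fun p => mup r (lead_coef p))).
rewrite !expr2 !lead_coefM lcD.
rewrite !mupM ?mulf_neq0 ?X0 ?lead_coef_eq0 // (mupNroot rw) addn0.
rewrite -['X - _]expr1 mup_XsubCX eqxx !addnn => /(congr1 odd).
by rewrite oddD !odd_double.
Qed.

(** The product of the remainders a + b X and c + d X vanishes modulo the
    quadratic, hence so does the product of their norms; and the norm
    a^2 - a b p + b^2 q vanishes only if (2 a - b p)^2 is b^2 times the
    discriminant. *)
Lemma monic_quadratic_prime (A : idomainType) (p q : A) :
    (forall u v : A, u ^+ 2 = v ^+ 2 * (p ^+ 2 - 4%:R * q) -> v = 0) ->
    let f : {poly A} := 'X^2 + p *: 'X + q%:P in
  forall g h : {poly A}, Pdiv.Ring.rdvdp f (g * h) ->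
    Pdiv.Ring.rdvdp f g || Pdiv.Ring.rdvdp f h.
Proof.
move=> nonsq f g h.
have sz_tail : (size (p *: 'X + q%:P)%R < 3)%N.
  rewrite (leq_ltn_trans (size_polyD _ _)) // gtn_max.
  by rewrite (leq_ltn_trans (size_scale_leq _ _)) ?size_polyX //
             (leq_ltn_trans (size_polyC_leq1 _)).
have fE : f = 'X^2 + (p *: 'X + q%:P) by rewrite addrA.
have szf : size f = 3%N by rewrite fE size_polyDl size_polyXn.
have monf : f \is monic.
  by rewrite monicE fE lead_coefDl ?size_polyXn // lead_coefXn.
have small (r : {poly A}) : (size r < 3)%N -> r = r`_1 *: 'X + (r`_0)%:P.
  move=> szr; apply/polyP => -[|[|i]]; rewrite coefD coefZ coefX coefC /=.
  - by rewrite mulr0 add0r.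
  - by rewrite mulr1 addr0.
  - by rewrite mulr0 addr0 nth_default // -ltnS (leq_trans szr).
have norm0 a b : a ^+ 2 - a * b * p + b ^+ 2 * q = 0 -> b *: 'X + a%:P = 0.
  move=> N0; suff b0 : b = 0.
    move: N0; rewrite b0 mulr0 mul0r subr0 expr0n mul0r addr0 => /eqP.
    by rewrite sqrf_eq0 => /eqP->; rewrite scale0r add0r.
  apply: (nonsq (2%:R * a - b * p)); apply/eqP; rewrite -subr_eq0; apply/eqP.
  by rewrite -[RHS](mulr0 4%:R) -N0; ring.
set r := Pdiv.Ring.rmodp g f; set s := Pdiv.Ring.rmodp h f.
have szr : (size r < 3)%N by rewrite -szf Pdiv.Ring.ltn_rmodpN0 ?monic_neq0.
have szs : (size s < 3)%N by rewrite -szf Pdiv.Ring.ltn_rmodpN0 ?monic_neq0.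
rewrite /Pdiv.Ring.rdvdp -(Pdiv.RingMonic.rmodp_mulmr monf).
rewrite -(Pdiv.RingMonic.rmodp_mulml monf) -/r -/s.
set b := r`_1; set a := r`_0; set d := s`_1; set c := s`_0.
have -> : r * s = (b * d)%:P * f
    + ((a * d + b * c - b * d * p) *: 'X + (a * c - b * d * q)%:P).
  rewrite (small r szr) (small s szs) -/a -/b -/c -/d /f -!mul_polyC.
  move: ('X : {poly A}) => X.
  by rewrite !(polyCM, polyCD, polyCN); ring.
rewrite Pdiv.RingMonic.rmodp_addl_mul_small //; last first.
  rewrite szf (leq_ltn_trans (size_polyD _ _)) // gtn_max.
  by rewrite (leq_ltn_trans (size_scale_leq _ _)) ?size_polyX //
             (leq_ltn_trans (size_polyC_leq1 _)).
move/eqP => prod0.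
have /= e1 := congr1 (fun t : {poly A} => t`_1) prod0.
have /= e0 := congr1 (fun t : {poly A} => t`_0) prod0.
move: e1 e0; rewrite !coefE /= mulr1 addr0 mulr0 add0r => e1 e0.
have : (a ^+ 2 - a * b * p + b ^+ 2 * q) * (c ^+ 2 - c * d * p + d ^+ 2 * q) = 0.
  have -> : (a ^+ 2 - a * b * p + b ^+ 2 * q) * (c ^+ 2 - c * d * p + d ^+ 2 * q)
    = (a * c - b * d * q) ^+ 2
      - (a * c - b * d * q) * (a * d + b * c - b * d * p) * p
      + (a * d + b * c - b * d * p) ^+ 2 * q by ring.
  by rewrite e0 e1; ring.
move/eqP; rewrite mulf_eq0 => /orP[] /eqP /norm0 N0.
  by rewrite (small r szr) N0 eqxx.
by rewrite (small s szs) N0 eqxx orbT.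
Qed.

(** * Height of ideals *)

Section HeightUniqueness.
Variable A : comNzRingType.

(** Drop the smallest primes of the chain. *)
Lemma height_ge_le (P : {pred A}) m n :
  (m <= n)%N -> height_ge P n -> height_ge P m.
Proof.
move=> lemn [Q [primeQ ltQ QP]]; exists (fun i => Q (i + (n - m))%N).
split=> [i leim|i ltim|]; last by rewrite subnKC.
  by apply: primeQ; rewrite -{2}(subnKC lemn) leq_add2r.
by rewrite addSn; apply: ltQ; rewrite -{2}(subnKC lemn) ltn_add2r.
Qed.

Lemma has_codim_uniq (J : A -> Prop) m n :
  has_codim J m -> has_codim J n -> m = n.
Proof.
move=> [geJm [P [JP ltP]]] [geJn [Q [JQ ltQ]]]; case: (ltngtP m n) => // lt.
  by case: ltP; apply: height_ge_le lt (geJn P JP).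
by case: ltQ; apply: height_ge_le lt (geJm Q JQ).
Qed.

End HeightUniqueness.

Section PrincipalPrime.
Variable A : idomainType.

Lemma prime_ideal0 : prime_ideal (pred1 (0 : A)).
Proof.
split; last by move=> u v; rewrite !inE mulf_eq0.
split; rewrite ?inE ?oner_eq0 // => a u v; rewrite !inE => /eqP-> /eqP->.
by rewrite mulr0 addr0.
Qed.

Lemma prime_ideal_mul (P : {pred A}) a u :
  prime_ideal P -> u \in P -> a * u \in P.
Proof. by case=> [[P0 _ PD] _] Pu; rewrite -[a * u]addr0 PD. Qed.

(** Krull's principal ideal theorem for a prime element u, in a ring with a
    degree: a nonzero prime ideal strictly inside (u) does not contain u, so it
    contains g / u along with each of its elements g, and infinite descent on
    the degree applies. *)
Lemma has_codim_prime_element (S : A -> Prop) (u : A) (P : {pred A})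
    (deg : A -> nat) :
    (forall p, S p <-> p = u) -> prime_ideal P -> u != 0 ->
    (forall g, g \in P -> exists h, g = h * u) ->
    u \in P ->
    (forall h : A, h != 0 -> (deg h < deg (h * u)%R)%N) ->
  has_codim (ideal_gen S) 1.
Proof.
move=> Su primeP u0 Pmul Pu degM.
have inP Q g : prime_ideal Q -> u \in Q -> ideal_gen S g -> g \in Q.
  move=> primeQ Qu [m [a [h [Sh ->]]]].
  case: (primeQ) => [[Q0 _ QD] _]; elim/big_ind: _ => [//|x y Qx Qy|i _].
    by rewrite -[x]mul1r QD.
  by rewrite ((Su _).1 (Sh i)); apply: prime_ideal_mul.
have Iu : ideal_gen S u by apply: ideal_gen_sub; apply/Su.
split=> [Q [primeQ IQ]|].
  exists (fun i => if i is 0%N then pred1 0 : {pred A} else Q).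
  split=> // [[|i] //|[|//] _].
    by move=> _; apply: prime_ideal0.
  split=> [g|QQ0]; last by have := QQ0 _ (IQ _ Iu); rewrite inE (negPf u0).
  by rewrite inE => /eqP->; case: primeQ => [[]].
exists P; split; first by split=> // g; apply: inP.
case=> Q [primeQ ltQ QP].
have [Q01 nQ01] := ltQ 0%N isT; have [Q12 nQ12] := ltQ 1%N isT.
have primeQ0 := primeQ 0%N isT; have primeQ1 := primeQ 1%N isT.
have Q1u : u \notin Q 1%N.
  apply/negP => Q1u; apply: nQ12 => g; rewrite QP => /Pmul[h ->].
  exact: prime_ideal_mul.
apply: nQ01 => g Q1g; suff -> : g = 0 by case: primeQ0 => [[]].
have [n] := ubnP (deg g); elim: n g Q1g => // n IH g Q1g ltgn.
have [//|g0] := eqVneq g 0.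
have [h Dg] : exists h, g = h * u by apply: Pmul; rewrite -QP Q12.
have h0 : h != 0 by apply: contraNneq g0 => h0; rewrite Dg h0 mul0r.
have Q1h : h \in Q 1%N.
  by case: (primeQ1) => _ /(_ h u); rewrite -Dg (negPf Q1u) orbF; apply.
have := degM h h0; rewrite -Dg => lthg.
by rewrite Dg (IH h Q1h (leq_trans lthg ltgn)) mul0r.
Qed.

End PrincipalPrime.

(** * Polynomials in three variables as iterated polynomials *)

Section EvalMap.
Variables (R S : comNzRingType) (f : {rmorphism R -> S}) (s : S).

Definition eval_map : {poly R} -> S := horner_eval s \o map_poly f.
HB.instance Definition _ := GRing.RMorphism.on eval_map.

Lemma eval_mapC c : eval_map c%:P = f c.
Proof. by rewrite /eval_map /= map_polyC horner_evalE hornerC. Qed.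

Lemma eval_mapX : eval_map 'X = s.
Proof. by rewrite /eval_map /= map_polyX horner_evalE hornerX. Qed.

End EvalMap.

Section IteratedPolynomials.
Variable K : fieldType.
Implicit Type g : {mpoly K[3]}.

(** The variable 0 is innermost and the variable 2 outermost. *)
Definition iter_var (i : 'I_3) : {poly {poly {poly K}}} :=
  match val i with 0 => 'X%:P%:P | 1 => 'X%:P | _ => 'X end.

Definition to_iter : {mpoly K[3]} -> {poly {poly {poly K}}} :=
  mmap (polyC \o polyC \o polyC) iter_var.
HB.instance Definition _ := GRing.RMorphism.on to_iter.

Definition of_iter : {poly {poly {poly K}}} -> {mpoly K[3]} :=
  eval_map (eval_map (eval_map (@mpolyC 3 K) 'X_0) 'X_1) 'X_2.
HB.instance Definition _ := GRing.RMorphism.on of_iter.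

Lemma to_iterC c : to_iter c%:MP = c%:P%:P%:P.
Proof. by rewrite /to_iter mmapC. Qed.

Lemma to_iterX i : to_iter 'X_i = iter_var i.
Proof. by rewrite /to_iter mmapX mmap1U. Qed.

Lemma to_iterK : cancel to_iter of_iter.
Proof.
move=> g; rewrite -[RHS]/(idfun g) -[LHS]/((of_iter \o to_iter) g).
apply: mpoly_rmorph_eq => [c|i] /=.
  by rewrite to_iterC /of_iter; do 3!rewrite eval_mapC /=.
rewrite to_iterX /iter_var /of_iter; case: i => [[|[|[|//]]] lti] /=.
- by do 2!rewrite eval_mapC /=; rewrite eval_mapX; congr 'X__; apply: val_inj.
- by rewrite eval_mapC /= eval_mapX; congr 'X__; apply: val_inj.
- by rewrite eval_mapX; congr 'X__; apply: val_inj.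
Qed.

End IteratedPolynomials.

(** * The cubic surface *)

Definition u4_val (A : comNzRingType) (a b c d x y z : A) : A :=
  4%:R - a ^+ 2 - b ^+ 2 - c ^+ 2 - d ^+ 2 - a * b * c * d
  + (a * b + c * d) * x + (a * c + b * d) * y + (b * c + a * d) * z
  - x ^+ 2 - y ^+ 2 - z ^+ 2 - x * y * z.

Lemma rmorph_u4_val (A B : comNzRingType) (f : {rmorphism A -> B})
    (a b c d x y z : A) :
  f (u4_val a b c d x y z) = u4_val (f a) (f b) (f c) (f d) (f x) (f y) (f z).
Proof. by rewrite /u4_val; ring. Qed.

Definition u4_lin (A : comNzRingType) (a b c d x y : A) : A :=
  x * y - (b * c + a * d).

Definition u4_cst (A : comNzRingType) (a b c d x y : A) : A :=
  x ^+ 2 + y ^+ 2 - (a * b + c * d) * x - (a * c + b * d) * y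
  + a ^+ 2 + b ^+ 2 + c ^+ 2 + d ^+ 2 + a * b * c * d - 4%:R.

Lemma u4_quadratic (A B : comNzRingType) (f : {rmorphism A -> B})
    (a b c d x y : A) (z : B) :
  u4_val (f a) (f b) (f c) (f d) (f x) (f y) z =
  - (z ^+ 2 + f (u4_lin a b c d x y) * z + f (u4_cst a b c d x y)).
Proof. by rewrite /u4_val /u4_lin /u4_cst; ring. Qed.

Lemma u4_disc_quadratic (A B : comNzRingType) (f : {rmorphism A -> B})
    (a b c d x : A) (y : B) :
  u4_lin (f a) (f b) (f c) (f d) (f x) y ^+ 2
  - 4%:R * u4_cst (f a) (f b) (f c) (f d) (f x) y =
  f (x ^+ 2 - 4%:R) * y ^+ 2
  + (f (4%:R * (a * c + b * d) - 2%:R * (b * c + a * d) * x) * y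
     + f ((b * c + a * d) ^+ 2 - 4%:R * u4_cst a b c d x 0)).
Proof. by rewrite /u4_lin /u4_cst; ring. Qed.

Section CubicSurface.
Variables (K : fieldType) (b : 'I_4 -> K).

Lemma u4_atE : u4_at b =
  u4_val (b (t_ 0))%:MP (b (t_ 1))%:MP (b (t_ 2))%:MP (b (t_ 3))%:MP
         'X_(x_ 0) 'X_(x_ 1) 'X_(x_ 2).
Proof.
rewrite /u4_at -[u4 K]/(u4_val _ _ _ _ _ _ _) rmorph_u4_val.
by rewrite /= !map_mpolyC !map_mpolyX /= !mevalXU.
Qed.

Lemma u4_at_meval v : (u4_at b).@[v] =
  u4_val (b (t_ 0)) (b (t_ 1)) (b (t_ 2)) (b (t_ 3))
         (v (x_ 0)) (v (x_ 1)) (v (x_ 2)).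
Proof. by rewrite u4_atE rmorph_u4_val /= !mevalC !mevalXU. Qed.

Let a1 := b (t_ 0).
Let a2 := b (t_ 1).
Let a3 := b (t_ 2).
Let a4 := b (t_ 3).

Lemma mderiv_x (i j : 'I_3) : ('X_i : {mpoly K[3]})^`M(j) = (i == j)%:R.
Proof.
rewrite mderivX mnm1E; case: eqP => [->|_]; last by rewrite scale0r.
by rewrite -{1}[U_(j)%MM]add0m addmK mpolyX0 scale1r.
Qed.

Let mderivE := (mderivB, mderivD, mderivM, mderivC, mderiv_x, expr2, mpolyC1).

Lemma mderiv_u4_at0 : (u4_at b)^`M(x_ 0) =
  (a1 * a2 + a3 * a4)%:MP - 2%:R * 'X_(x_ 0) - 'X_(x_ 1) * 'X_(x_ 2).
Proof.
rewrite u4_atE /u4_val -mpolyC_nat !mderivE /= !(mpolyCD, mpolyCM).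
rewrite /a1 /a2 /a3 /a4.
move: (b _)%:MP (b _)%:MP (b _)%:MP (b _)%:MP 'X_(x_ 0) 'X_(x_ 1) 'X_(x_ 2).
by move=> t1 t2 t3 t4 x y z; ring.
Qed.

Lemma mderiv_u4_at1 : (u4_at b)^`M(x_ 1) =
  (a1 * a3 + a2 * a4)%:MP - 2%:R * 'X_(x_ 1) - 'X_(x_ 0) * 'X_(x_ 2).
Proof.
rewrite u4_atE /u4_val -mpolyC_nat !mderivE /= !(mpolyCD, mpolyCM).
rewrite /a1 /a2 /a3 /a4.
move: (b _)%:MP (b _)%:MP (b _)%:MP (b _)%:MP 'X_(x_ 0) 'X_(x_ 1) 'X_(x_ 2).
by move=> t1 t2 t3 t4 x y z; ring.
Qed.

Lemma mderiv_u4_at2 : (u4_at b)^`M(x_ 2) =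
  (a2 * a3 + a1 * a4)%:MP - 2%:R * 'X_(x_ 2) - 'X_(x_ 0) * 'X_(x_ 1).
Proof.
rewrite u4_atE /u4_val -mpolyC_nat !mderivE /= !(mpolyCD, mpolyCM).
rewrite /a1 /a2 /a3 /a4.
move: (b _)%:MP (b _)%:MP (b _)%:MP (b _)%:MP 'X_(x_ 0) 'X_(x_ 1) 'X_(x_ 2).
by move=> t1 t2 t3 t4 x y z; ring.
Qed.

Hypothesis nz2 : 2%:R != 0 :> K.

Let lin : {poly {poly K}} :=
  u4_lin a1%:P%:P a2%:P%:P a3%:P%:P a4%:P%:P 'X%:P 'X.
Let cst : {poly {poly K}} :=
  u4_cst a1%:P%:P a2%:P%:P a3%:P%:P a4%:P%:P 'X%:P 'X.
Let quad : {poly {poly {poly K}}} := 'X^2 + lin *: 'X + cst%:P.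

Lemma to_iter_u4_at : to_iter (u4_at b) = - quad.
Proof.
pose F : {rmorphism {mpoly K[3]} -> {poly {poly {poly K}}}} := @to_iter K.
rewrite u4_atE (rmorph_u4_val F) /F /= !to_iterC !to_iterX /iter_var /=.
by rewrite (u4_quadratic polyC) /quad -mul_polyC.
Qed.

(** The discriminant has leading coefficient x1^2 - 4 = (x1 - 2) (x1 + 2) in
    x2. *)
Lemma u4_disc_nonsquare (u v : {poly {poly K}}) :
  u ^+ 2 = v ^+ 2 * (lin ^+ 2 - 4%:R * cst) -> v = 0.
Proof.
apply: (@lead_simple_root_nonsquare _ _ 2%:R ('X + 2%:R%:P)); last first.
  have E22 : 2%:R + 2%:R = 2%:R * 2%:R :> K by ring.
  by rewrite /root hornerD hornerX hornerC E22 mulf_neq0.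
rewrite /lin /cst (u4_disc_quadratic polyC) /= !mul_polyC.
set B1 := (X in X *: 'X); set B0 := (X in _ + X%:P).
have -> : 'X ^+ 2 - 4%:R = ('X - 2%:R%:P) * ('X + 2%:R%:P) :> {poly K}.
  by rewrite polyC_natr; ring.
have A0 : ('X - 2%:R%:P) * ('X + 2%:R%:P) != 0 :> {poly K}.
  by rewrite mulf_neq0 ?polyXsubC_eq0 // -[2%:R%:P]opprK -polyCN polyXsubC_eq0.
rewrite lead_coefDl; first by rewrite lead_coefZ lead_coefXn mulr1.
rewrite size_scale // size_polyXn (leq_ltn_trans (size_polyD _ _)) // gtn_max.
by rewrite (leq_ltn_trans (size_scale_leq _ _)) ?size_polyX //
           (leq_ltn_trans (size_polyC_leq1 _)).
Qed.

Let size_quad : size quad = 3%N /\ quad \is monic.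
Proof.
have sz : (size (lin *: 'X + cst%:P)%R < 3)%N.
  rewrite (leq_ltn_trans (size_polyD _ _)) // gtn_max.
  by rewrite (leq_ltn_trans (size_scale_leq _ _)) ?size_polyX //
             (leq_ltn_trans (size_polyC_leq1 _)).
rewrite monicE /quad -addrA size_polyDl ?lead_coefDl ?size_polyXn //.
by rewrite lead_coefXn.
Qed.

Lemma has_codim_u4_at : has_codim (ideal_gen (gens (fun _ : 'I_1 => u4_at b))) 1.
Proof.
have [szq monq] := size_quad.
have q0 := monic_neq0 monq.
have toK : injective (@to_iter K) := can_inj (@to_iterK K).
have to_neq0 (h : {mpoly K[3]}) : h != 0 -> to_iter h != 0.
  by apply: contraNneq => h0; apply/eqP/toK; rewrite h0 rmorph0.
pose P : {pred {mpoly K[3]}} := [pred g | Pdiv.Ring.rdvdp quad (to_iter g)].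
apply: (@has_codim_prime_element _ _ (u4_at b) P (fun g => size (to_iter g))).
- by move=> p; split=> [[]//|->]; exists ord0.
- split; last first.
    move=> u v; rewrite !inE rmorphM; apply: monic_quadratic_prime.
    exact: u4_disc_nonsquare.
  split; first by rewrite inE rmorph0 Pdiv.Ring.rdvdp0.
    by rewrite inE rmorph1 Pdiv.Ring.rdvdp1 szq.
  move=> a u v; rewrite !inE => /(Pdiv.RingMonic.rdvdpP monq)[s Du].
  move=> /(Pdiv.RingMonic.rdvdpP monq)[t Dv]; apply/(Pdiv.RingMonic.rdvdpP monq).
  rewrite rmorphD rmorphM /= Du Dv.
  by exists (to_iter a * s + t); rewrite mulrDl mulrA.
- apply: contra_neq q0 => u0; rewrite -[quad]opprK -to_iter_u4_at u0.
  by rewrite rmorph0 oppr0.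
- move=> g; rewrite inE => /(Pdiv.RingMonic.rdvdpP monq)[s Dg].
  exists (of_iter (- s)); rewrite -[u4_at b]to_iterK -rmorphM /= to_iter_u4_at.
  by rewrite mulrNN -Dg to_iterK.
- by rewrite inE to_iter_u4_at -mulN1r Pdiv.RingMonic.rdvdp_mull.
move=> h h0; rewrite rmorphM /= to_iter_u4_at mulrN size_polyN size_mul ?to_neq0 //.
by rewrite szq addn3.
Qed.

End CubicSurface.

(** * Singular points *)

(** u4 and its three partial derivatives vanish. *)
Definition sing_point (A : comNzRingType) (a b c d x y z : A) : Prop :=
  [/\ u4_val a b c d x y z = 0,
      a * b + c * d - 2%:R * x - y * z = 0,
      a * c + b * d - 2%:R * y - x * z = 0 &
      b * c + a * d - 2%:R * z - x * y = 0].

(** tr [A, B] - 2, where a = tr A, b = tr B and x = tr A B. *)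
Definition kappa (A : comNzRingType) (a b x : A) : A :=
  x ^+ 2 - a * b * x + a ^+ 2 + b ^+ 2 - 4%:R.

(** Delta as the resultant in x of kappa a b x and kappa c d x. *)
Definition delta (A : comNzRingType) (a b c d : A) : A :=
  (a ^+ 2 + b ^+ 2 - c ^+ 2 - d ^+ 2) ^+ 2
  + (c * d - a * b) * (c * d * (a ^+ 2 + b ^+ 2 - 4%:R)
                       - a * b * (c ^+ 2 + d ^+ 2 - 4%:R)).

Section SingularPoints.
Variable K : closedFieldType.
Hypothesis nz2 : 2%:R != 0 :> K.
Implicit Types a b c d x y z : K.

Lemma delta_swap12 a b c d : delta b a c d = delta a b c d.
Proof. by rewrite /delta; ring. Qed.

Lemma delta_swap23 a b c d : delta a c b d = delta a b c d.
Proof. by rewrite /delta; ring. Qed.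

Lemma delta_swap34 a b c d : delta a b d c = delta a b c d.
Proof. by rewrite /delta; ring. Qed.

Lemma sing_swap12 a b c d x y z :
  sing_point a b c d x y z -> sing_point b a c d x z y.
Proof.
rewrite /sing_point /u4_val => -[U E1 E2 E3].
by split; [rewrite -U|rewrite -E1|rewrite -E3|rewrite -E2]; ring.
Qed.

Lemma sing_swap23 a b c d x y z :
  sing_point a b c d x y z -> sing_point a c b d y x z.
Proof.
rewrite /sing_point /u4_val => -[U E1 E2 E3].
by split; [rewrite -U|rewrite -E2|rewrite -E1|rewrite -E3]; ring.
Qed.

Lemma sing_swap34 a b c d x y z :
  sing_point a b c d x y z -> sing_point a b d c x z y.
Proof.
rewrite /sing_point /u4_val => -[U E1 E2 E3].
by split; [rewrite -U|rewrite -E1|rewrite -E3|rewrite -E2]; ring.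
Qed.

(** The discriminant D of u4 in z equals (d u4 / dz)^2 + 4 u4, and D is a
    quadratic polynomial in y of discriminant 16 kappa a b x * kappa c d x. At a
    singular point D and its derivative in y vanish, hence so does the
    discriminant of D. *)
Lemma sing_kappa12 a b c d x y z :
  sing_point a b c d x y z -> kappa a b x * kappa c d x = 0.
Proof.
case=> U _; set E2 := (X in X = 0) => Z2; set E3 := (X in X = 0) => Z3.
have -> : kappa a b x * kappa c d x = E2 ^+ 2 + E3 ^+ 2 - x * E2 * E3
    - (x ^+ 2 - 4%:R) * u4_val a b c d x y z.
  by rewrite /kappa /E2 /E3 /u4_val; ring.
by rewrite U Z2 Z3; ring.
Qed.

Lemma sing_kappa13 a b c d x y z :
  sing_point a b c d x y z -> kappa a c y * kappa b d y = 0.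
Proof. by move/sing_swap23/sing_kappa12. Qed.

Lemma sing_kappa23 a b c d x y z :
  sing_point a b c d x y z -> kappa b c z * kappa a d z = 0.
Proof. by move/sing_swap12/sing_swap23/sing_kappa12. Qed.

(** The left side minus the right side is u4 - x u4_x - y u4_y - z u4_z, with
    subscripts for partial derivatives. *)
Lemma sing_euler a b c d x y z : sing_point a b c d x y z ->
  4%:R + x ^+ 2 + y ^+ 2 + z ^+ 2 + 2%:R * x * y * z
  = a ^+ 2 + b ^+ 2 + c ^+ 2 + d ^+ 2 + a * b * c * d.
Proof.
rewrite /sing_point /u4_val => -[U].
set E1 := (X in X = 0) => Z1; set E2 := (X in X = 0) => Z2.
set E3 := (X in X = 0) => Z3; apply/eqP; rewrite -subr_eq0; apply/eqP.
rewrite -[RHS](subr0 0) -[X in X - 0]U -[X in _ - X](mulr0 x) -Z1.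
transitivity (u4_val a b c d x y z - x * E1 - y * E2 - z * E3).
  by rewrite /u4_val /E1 /E2 /E3; ring.
by rewrite Z2 Z3 /u4_val; ring.
Qed.

(** A trace of SL(2) determines an eigenvalue s up to inversion. *)
Lemma trace_param a : exists2 s : K, s != 0 & a = s + s^-1.
Proof.
have [s Ds] := @solve_monicpoly K 2 (fun i => if i is 0%N then -1 else a) isT.
rewrite !big_ord_recl big_ord0 /= expr0 expr1 mulr1 addr0 in Ds.
have s0 : s != 0.
  apply: contra_eq_neq Ds => ->; rewrite expr0n mulr0 addr0 eq_sym.
  by rewrite oppr_eq0 oner_eq0.
exists s => //; apply: (mulfI s0).
by rewrite mulrDr mulfV // -expr2 Ds; ring.
Qed.

Lemma kappa_param (s t x : K) : s != 0 -> t != 0 ->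
  kappa (s + s^-1) (t + t^-1) x =
  (x - (s * t + (s * t)^-1)) * (x - (s / t + t / s)).
Proof. by move=> s0 t0; rewrite /kappa; field; rewrite s0 t0. Qed.

Lemma kappa_eq0 (s b x : K) : s != 0 -> kappa (s + s^-1) b x = 0 ->
  exists t : K, [/\ t != 0, b = t + t^-1 & x = s * t + (s * t)^-1].
Proof.
move=> s0; have [t t0 ->] := trace_param b.
rewrite kappa_param // => /eqP; rewrite mulf_eq0 !subr_eq0 => /orP[]/eqP->.
  by exists t.
by exists t^-1; rewrite invr_eq0 invrK addrC; split=> //; field; rewrite s0 t0.
Qed.

(** The boundary traces of a diagonal representation: the eigenvalues s, t, r
    and (s t r)^-1 multiply to 1. *)
Lemma delta_reducible (s t r : K) : s != 0 -> t != 0 -> r != 0 ->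
  delta (s + s^-1) (t + t^-1) (r + r^-1) (s * t * r + (s * t * r)^-1) = 0.
Proof. by move=> s0 t0 r0; rewrite /delta; field; rewrite s0 t0 r0. Qed.

Lemma trace_sqr_neq4 (s : K) : s != 0 -> (s + s^-1) ^+ 2 != 4%:R -> s ^+ 2 != 1.
Proof.
move=> s0; apply: contra_neq => s2.
rewrite sqrrD exprVn s2 invr1 mulfV //; ring.
Qed.

Lemma trace_of_sign (s u : K) : s != 0 -> u != 0 -> (s * u) ^+ 2 = 1 ->
  u + u^-1 = (s * u) * (s + s^-1) /\ s * u + (s * u)^-1 = 2%:R * (s * u).
Proof.
move=> s0 u0 sq_u; have V : (s * u)^-1 = s * u.
  by apply: (mulfI (mulf_neq0 s0 u0)); rewrite mulfV ?mulf_neq0 // -expr2 sq_u.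
have Vu : u^-1 = s * (s * u) by rewrite -[in RHS]V invfM mulrA mulfV ?mul1r.
have Vs : s^-1 = u * (s * u).
  by rewrite -V invfM [s^-1 * _]mulrC mulrA mulfV ?mul1r.
split; last by rewrite V; ring.
rewrite Vs Vu mulrDr.
have -> : s * u * (u * (s * u)) = (s * u) ^+ 2 * u by ring.
by rewrite sq_u; ring.
Qed.

(** With eigenvalues s, t, r, q of the four boundary matrices, chosen so that
    x = s t + (s t)^-1, y = s r + (s r)^-1 and z = s q + (s q)^-1, the partial
    derivative in x is (s^2 - 1) (t + s r q) (s t r q - 1) up to a unit, and the
    two others are obtained by exchanging t with r or q. If s t r q is not 1,
    then s t, s r and s q are signs of product -1; the remaining equation forces
    all boundary traces to be 0. *)
Lemma star_delta a b c d x y z : sing_point a b c d x y z ->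
  a ^+ 2 != 4%:R -> kappa a b x = 0 -> kappa a c y = 0 -> kappa a d z = 0 ->
  delta a b c d = 0.
Proof.
have [s s0 ->] := trace_param a => S a4.
have s1 := trace_sqr_neq4 s0 a4.
move=> /(kappa_eq0 s0)[t [t0 Db Dx]] /(kappa_eq0 s0)[r [r0 Dc Dy]].
move=> /(kappa_eq0 s0)[q [q0 Dd Dz]].
have [P1|P1] := eqVneq (s * t * r * q) 1.
  have Dq : q = (s * t * r)^-1.
    apply: (mulfI (mulf_neq0 (mulf_neq0 s0 t0) r0)).
    by rewrite P1 mulfV // !mulf_neq0.
  have -> : d = s * t * r + (s * t * r)^-1 by rewrite Dd Dq invrK addrC.
  by rewrite Db Dc delta_reducible.
have s1' : s ^+ 2 - 1 != 0 by rewrite subr_eq0.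
have P1' : s * t * r * q - 1 != 0 by rewrite subr_eq0.
case: (S) => _ E1 E2 E3.
have /eqP e1 : (s ^+ 2 - 1) * (t + s * r * q) * (s * t * r * q - 1) = 0.
  rewrite -[RHS](mulr0 (- (s ^+ 2 * t * r * q))) -E1 Db Dc Dd Dx Dy Dz.
  by field; rewrite s0 t0 r0 q0.
have /eqP e2 : (s ^+ 2 - 1) * (r + s * t * q) * (s * t * r * q - 1) = 0.
  rewrite -[RHS](mulr0 (- (s ^+ 2 * t * r * q))) -E2 Db Dc Dd Dx Dy Dz.
  by field; rewrite s0 t0 r0 q0.
have /eqP e3 : (s ^+ 2 - 1) * (q + s * t * r) * (s * t * r * q - 1) = 0.
  rewrite -[RHS](mulr0 (- (s ^+ 2 * t * r * q))) -E3 Db Dc Dd Dx Dy Dz.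
  by field; rewrite s0 t0 r0 q0.
move: e1 e2 e3; rewrite !mulf_eq0 (negPf s1') (negPf P1') /= !orbF !addr_eq0.
move=> /eqP e1 /eqP e2 /eqP e3.
have sq_eq1 (u v w : K) : v != 0 -> v = - (s * w * u) -> w = - (s * v * u) ->
    (s * u) ^+ 2 = 1.
  by move=> v0 Dv Dw; apply: (mulIf v0); rewrite mul1r [RHS]Dv Dw; ring.
have sq_q : (s * q) ^+ 2 = 1 by apply: (sq_eq1 q t r).
have sq_r : (s * r) ^+ 2 = 1.
  by apply: (sq_eq1 r t q) => //; rewrite ?[LHS]e1 ?[LHS]e3; ring.
have Dst : s * t = - ((s * r) * (s * q)) by rewrite [t in LHS]e1; ring.
have sq_t : (s * t) ^+ 2 = 1 by rewrite Dst sqrrN exprMn sq_q sq_r mulr1.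
have [Pb Px] := trace_of_sign s0 t0 sq_t.
have [Pc Py] := trace_of_sign s0 r0 sq_r.
have [Pd Pz] := trace_of_sign s0 q0 sq_q.
rewrite -Db in Pb; rewrite -Dc in Pc; rewrite -Dd in Pd.
rewrite -Dx in Px; rewrite -Dy in Py; rewrite -Dz in Pz.
have := sing_euler S; rewrite Pb Pc Pd Px Py Pz.
set u := s * t in Dst sq_t *; set v := s * r in Dst sq_r *.
set w := s * q in Dst sq_q *; set A := s + s^-1 in a4 * => euler.
have Q : u * v * w = -1.
  transitivity (- (v ^+ 2 * w ^+ 2)); first by rewrite Dst; ring.
  by rewrite sq_r sq_q mulr1.
have : A ^+ 2 * (A ^+ 2 - 4%:R) = 0.
  rewrite -[RHS](subrr (A ^+ 2 + (u * A) ^+ 2 + (v * A) ^+ 2 + (w * A) ^+ 2 +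
     A * (u * A) * (v * A) * (w * A))) -{1}euler.
  have F3 : u ^+ 2 + v ^+ 2 + w ^+ 2 - 3%:R = 0 by rewrite sq_t sq_r sq_q; ring.
  have FQ : u * v * w + 1 = 0 by rewrite Q addNr.
  rewrite -[LHS]addr0 -(mulr0 (4%:R - A ^+ 2)) -F3.
  rewrite -[LHS]addr0 -[X in _ + X = _](mulr0 (16%:R - A ^+ 4)) -FQ.
  by ring.
move/eqP; rewrite mulf_eq0 subr_eq0 (negPf a4) orbF sqrf_eq0 => /eqP ->.
by rewrite !mulr0 /delta; ring.
Qed.

(** With eigenvalues s, t, r chosen so that x = s t + (s t)^-1 and
    y = s r + (s r)^-1, either z = t r + (t r)^-1 or z = t / r + r / t. In the
    first case the partial derivatives are d - (s t r + (s t r)^-1) times c, b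
    and a, so either d = s t r + (s t r)^-1 or a, b, c, and then d, are 0. In
    the second case, eliminating d from pairs of partial derivatives
    shows that s t and s r are signs, and then u4 = 0 becomes
    (4 - a^2)^3 = 0. *)
Lemma triangle_delta a b c d x y z : sing_point a b c d x y z ->
  a ^+ 2 != 4%:R -> b ^+ 2 != 4%:R -> c ^+ 2 != 4%:R ->
  kappa a b x = 0 -> kappa a c y = 0 -> kappa b c z = 0 ->
  delta a b c d = 0.
Proof.
have [s s0 Da] := trace_param a => S a4 b4 c4 kx ky kz.
move: (kx) (ky); rewrite Da => /(kappa_eq0 s0)[t [t0 Db Dx]].
move=> /(kappa_eq0 s0)[r [r0 Dc Dy]].
have s1 : s ^+ 2 - 1 != 0 by rewrite subr_eq0 trace_sqr_neq4 // -Da.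
have t1 : t ^+ 2 - 1 != 0 by rewrite subr_eq0 trace_sqr_neq4 // -Db.
have r1 : r ^+ 2 - 1 != 0 by rewrite subr_eq0 trace_sqr_neq4 // -Dc.
case: (S) => U E1 E2 E3; have := sing_euler S => euler.
move: (kz); rewrite {1}Db {1}Dc kappa_param // => /eqP.
rewrite mulf_eq0 !subr_eq0 => /orP[] /eqP Dz.
  have e1 : c * (d - (s * t * r + (s * t * r)^-1)) = 0.
    by rewrite -[RHS]E1 Da Db Dc Dx Dy Dz; field; rewrite s0 t0 r0.
  have e2 : b * (d - (s * t * r + (s * t * r)^-1)) = 0.
    by rewrite -[RHS]E2 Da Db Dc Dx Dy Dz; field; rewrite s0 t0 r0.
  have e3 : a * (d - (s * t * r + (s * t * r)^-1)) = 0.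
    by rewrite -[RHS]E3 Da Db Dc Dx Dy Dz; field; rewrite s0 t0 r0.
  have [Dd|nd] := eqVneq d (s * t * r + (s * t * r)^-1).
    by rewrite -Da Db Dc Dd Da delta_reducible.
  move: nd; rewrite -subr_eq0 => /mulIf nd.
  have a0 : a = 0 by apply: nd; rewrite mul0r.
  have b0 : b = 0 by apply: nd; rewrite mul0r.
  have c0 : c = 0 by apply: nd; rewrite mul0r.
  suff /eqP : d ^+ 2 = 0.
    rewrite -Da a0 b0 c0 sqrf_eq0 => /eqP->; rewrite /delta; ring.
  move: E1 euler kx ky kz; rewrite /kappa a0 b0 c0 => E1 euler kx ky kz.
  (* All of x^2, y^2, z^2 are 4 and y z = - 2 x, so d^2 = 4 - 12 + 8. *)
  have sq4 (w : K) :
      w ^+ 2 - 0 * 0 * w + 0 ^+ 2 + 0 ^+ 2 - 4%:R = 0 -> w ^+ 2 = 4%:R.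
    by move/eqP; rewrite subr_eq0 => /eqP <-; ring.
  have Dyz : y * z = - (2%:R * x).
    by apply/eqP; rewrite -subr_eq0 -oppr_eq0 -[X in _ == X]E1; apply/eqP; ring.
  transitivity (4%:R + x ^+ 2 + y ^+ 2 + z ^+ 2 + 2%:R * x * (y * z)).
    by transitivity (0 ^+ 2 + 0 ^+ 2 + 0 ^+ 2 + d ^+ 2 + 0 * 0 * 0 * d);
      [ring|rewrite -euler; ring].
  rewrite Dyz; transitivity (4%:R - 3%:R * x ^+ 2 + y ^+ 2 + z ^+ 2); first by ring.
  by rewrite (sq4 x kx) (sq4 y ky) (sq4 z kz); ring.
(* The case z = t / r + r / t is impossible. *)
exfalso.
have e12 : (s ^+ 2 - 1) * (t ^+ 2 - 1) * (r ^+ 2 - 1) * (t ^+ 2 - r ^+ 2) = 0.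
  transitivity (s * t ^+ 2 * r ^+ 2 * (c * 0 - b * 0)); last first.
    by rewrite !mulr0 subr0 mulr0.
  rewrite -{1}E2 -E1 Da Db Dc Dx Dy Dz; field; by rewrite s0 t0 r0.
have e13 : (s ^+ 2 - 1) * (t ^+ 2 - 1) * (r ^+ 2 - 1) * ((s * r) ^+ 2 - 1) = 0.
  transitivity (s ^+ 2 * t * r ^+ 2 * (a * 0 - c * 0)); last first.
    by rewrite !mulr0 subr0 mulr0.
  rewrite -{1}E1 -E3 Da Db Dc Dx Dy Dz; field; by rewrite s0 t0 r0.
move/eqP: e13; rewrite !mulf_eq0 (negPf s1) (negPf t1) (negPf r1) /= subr_eq0.
move=> /eqP sq_r; move/eqP: e12.
rewrite !mulf_eq0 (negPf s1) (negPf t1) (negPf r1) /= subr_eq0 => /eqP tr2.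
have sq_t : (s * t) ^+ 2 = 1 by rewrite exprMn tr2 -exprMn.
have [Pb Px] := trace_of_sign s0 t0 sq_t.
have [Pc Py] := trace_of_sign s0 r0 sq_r.
rewrite -Db -Da in Pb; rewrite -Dc -Da in Pc.
rewrite -Dx in Px; rewrite -Dy in Py.
have Pz : z = 2%:R * (s * t * (s * r)).
  have -> : z = (s * t * (s * r)) * ((s * r) ^+ 2)^-1
              + (s * t * (s * r)) * ((s * t) ^+ 2)^-1.
    by rewrite Dz; field; rewrite s0 t0 r0.
  by rewrite sq_r sq_t invr1; ring.
move: (s * t) (s * r) sq_t sq_r Pb Pc Px Py Pz => e f e2 f2 Pb Pc Px Py Pz.
have g2 : (e * f) ^+ 2 = 1 by rewrite exprMn e2 f2 mulr1.
(* With e, f = 1 or -1: b = e a, c = f a, x = 2 e, y = 2 f, z = 2 e f. *)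
have Dad : a * d = e * f * (8%:R - a ^+ 2).
  by apply/eqP; rewrite -subr_eq0 -[X in _ == X]E3 Pb Pc Px Py Pz; apply/eqP; ring.
have key : 32%:R - 3%:R * a ^+ 2 - d ^+ 2 - e * f * a ^+ 2 * (a * d) = 0.
  transitivity (4%:R + 4%:R * e ^+ 2 + 4%:R * f ^+ 2 + 4%:R * (e * f) ^+ 2
     + 16%:R * (e * f) ^+ 2
     - (a ^+ 2 * (1 + e ^+ 2 + f ^+ 2) + d ^+ 2 + e * f * a ^+ 2 * (a * d))).
    by rewrite e2 f2 g2; ring.
  rewrite -[RHS](subrr (a ^+ 2 + b ^+ 2 + c ^+ 2 + d ^+ 2 + a * b * c * d)).
  by rewrite -{1}euler Pb Pc Px Py Pz; ring.
suff : (4%:R - a ^+ 2) ^+ 3 = 0.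
  by move/eqP; rewrite expf_eq0 /= subr_eq0 eq_sym (negPf a4).
transitivity (- (a ^+ 2 * 0)); last by rewrite mulr0 oppr0.
rewrite -key.
transitivity (- (32%:R * a ^+ 2 - 3%:R * a ^+ 4 - (a * d) ^+ 2
                 - e * f * a ^+ 4 * (a * d))); last by ring.
rewrite Dad exprMn g2 mul1r.
have -> : e * f * a ^+ 4 * (e * f * (8%:R - a ^+ 2))
         = (e * f) ^+ 2 * (a ^+ 4 * (8%:R - a ^+ 2)).
  by ring.
by rewrite g2; ring.
Qed.

(** For each of the three ways of pairing the punctures, one of the two pairs
    is reducible; three such pairs either share a puncture or form a triangle. *)
Lemma sing_point_psi a b c d x y z : sing_point a b c d x y z ->
  delta a b c d ^+ 2 * ((a ^+ 2 - 4%:R) * (b ^+ 2 - 4%:R)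
                        * (c ^+ 2 - 4%:R) * (d ^+ 2 - 4%:R)) = 0.
Proof.
move=> S; apply/eqP; rewrite mulf_eq0 sqrf_eq0 !mulf_eq0 !subr_eq0.
case: (eqVneq (a ^+ 2)) => a4; first by rewrite orbT.
case: (eqVneq (b ^+ 2)) => b4; first by rewrite !orbT.
case: (eqVneq (c ^+ 2)) => c4; first by rewrite !orbT.
case: (eqVneq (d ^+ 2)) => d4; first by rewrite !orbT.
rewrite !orbF; apply/eqP.
have kC u v w : kappa u v w = 0 -> kappa v u w = 0.
  by move=> <-; rewrite /kappa; ring.
have S12 := sing_swap12 S; have S23 := sing_swap23 S; have S34 := sing_swap34 S.
have /eqP := sing_kappa12 S; rewrite mulf_eq0 => /orP[]/eqP kx;
have /eqP := sing_kappa13 S; rewrite mulf_eq0 => /orP[]/eqP ky;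
have /eqP := sing_kappa23 S; rewrite mulf_eq0 => /orP[]/eqP kz.
- exact: (triangle_delta S).
- exact: (star_delta S).
- by rewrite -delta_swap12; apply: (star_delta S12) => //; apply: kC.
- by rewrite -delta_swap34; apply: (triangle_delta S34).
- rewrite -delta_swap23 -delta_swap12.
  by apply: (star_delta (sing_swap12 S23)) => //; apply: kC.
- rewrite -delta_swap23 -delta_swap34.
  by apply: (triangle_delta (sing_swap34 S23)).
- rewrite -delta_swap12 -delta_swap23 -delta_swap34.
  by apply: (triangle_delta (sing_swap34 (sing_swap23 S12))).
- rewrite -delta_swap34 -delta_swap23 -delta_swap12.
  by apply: (star_delta (sing_swap12 (sing_swap23 S34))) => //; apply: kC.
Qed.

(** A common root x of kappa a b and kappa c d is both s u + (s u)^-1 and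
    r q + (r q)^-1, so that s u r q = 1 after possibly inverting r and q; the
    diagonal representation with eigenvalues s, u, r, q is a singular point. *)
Lemma delta_sing_point a b c d : delta a b c d = 0 ->
  exists x y z, sing_point a b c d x y z.
Proof.
have [s s0 ->] := trace_param a; have [t t0 ->] := trace_param b => D0.
have : kappa c d (s * t + (s * t)^-1) * kappa c d (s / t + t / s) = 0.
  by rewrite -[RHS]D0 /kappa /delta; field; rewrite s0 t0.
suff pt (u : K) : u != 0 -> kappa c d (s * u + (s * u)^-1) = 0 ->
    exists x y z, sing_point (s + s^-1) (u + u^-1) c d x y z.
  move/eqP; rewrite mulf_eq0 => /orP[]/eqP k0; first exact: (pt t).
  have -> : t + t^-1 = t^-1 + t^-1^-1 by rewrite invrK addrC.
  apply: (pt t^-1); first by rewrite invr_eq0.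
  by rewrite invfM invrK [s^-1 * t]mulrC.
move=> u0; have [r r0 ->] := trace_param c => /(kappa_eq0 r0)[q [q0 -> Dx]].
have pt3 (v : K) : v != 0 ->
    exists x y z, sing_point (s + s^-1) (u + u^-1) (v + v^-1)
                    (s * u * v + (s * u * v)^-1) x y z.
  move=> v0; exists (s * u + (s * u)^-1), (s * v + (s * v)^-1),
    (u * v + (u * v)^-1).
  by split; rewrite ?/u4_val; field; rewrite s0 u0 v0.
have : (s * u - r * q) * (s * u * (r * q) - 1) = 0.
  transitivity (s * u * (r * q) * ((s * u + (s * u)^-1) - (r * q + (r * q)^-1))).
    by field; rewrite s0 u0 r0 q0.
  by rewrite Dx subrr mulr0.
move/eqP; rewrite mulf_eq0 !subr_eq0 => /orP[]/eqP Du.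
  have -> : r + r^-1 = r^-1 + r^-1^-1 by rewrite invrK addrC.
  have -> : q = s * u * r^-1 by rewrite Du mulrAC mulfV ?mul1r.
  by apply: (pt3 r^-1); rewrite invr_eq0.
have -> : q = (s * u * r)^-1.
  apply: (mulfI (mulf_neq0 (mulf_neq0 s0 u0) r0)).
  by rewrite mulfV ?mulf_neq0 // -Du; ring.
by rewrite invrK [_^-1 + _]addrC; apply: (pt3 r).
Qed.

(** The first boundary matrix is e = 1 or -1 times the identity; multiplying
    another boundary matrix by it multiplies the trace by e. *)
Lemma central_sing_point a b c d : a ^+ 2 = 4%:R ->
  exists x y z, sing_point a b c d x y z.
Proof.
move=> a4; pose e := a / 2%:R.
have Da : a = 2%:R * e by rewrite /e mulrC divfK.
have e2 : e ^+ 2 = 1.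
  apply: (mulfI (mulf_neq0 nz2 nz2)); rewrite mulr1.
  by transitivity (a ^+ 2); [rewrite Da; ring | rewrite a4; ring].
exists (e * b), (e * c), (e * d); rewrite Da /sing_point /u4_val; split.
- transitivity ((1 - e ^+ 2) * (4%:R - b ^+ 2 - c ^+ 2 - d ^+ 2 + e * b * c * d)).
    by ring.
  by rewrite e2 subrr mul0r.
- by transitivity ((1 - e ^+ 2) * (c * d)); [ring | rewrite e2 subrr mul0r].
- by transitivity ((1 - e ^+ 2) * (b * d)); [ring | rewrite e2 subrr mul0r].
- by transitivity ((1 - e ^+ 2) * (b * c)); [ring | rewrite e2 subrr mul0r].
Qed.

Lemma psi_sing_point a b c d :
  delta a b c d ^+ 2 * ((a ^+ 2 - 4%:R) * (b ^+ 2 - 4%:R)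
                        * (c ^+ 2 - 4%:R) * (d ^+ 2 - 4%:R)) = 0 ->
  exists x y z, sing_point a b c d x y z.
Proof.
move/eqP; rewrite mulf_eq0 sqrf_eq0 !mulf_eq0 !subr_eq0.
case/orP=> [/eqP/delta_sing_point //|/orP[/orP[/orP[]|]|]] /eqP sq4.
- exact: central_sing_point.
- have [x [y [z]]] := central_sing_point a c d sq4.
  by move/sing_swap12; exists x, z, y.
- have [x [y [z]]] := central_sing_point a b d sq4.
  by move/sing_swap12/sing_swap23; exists z, x, y.
- have [x [y [z]]] := central_sing_point a b c sq4.
  by move/sing_swap12/sing_swap23/sing_swap34; exists z, y, x.
Qed.

End SingularPoints.

(** * The Jacobian criterion *)

(** Eliminating x, then y, between the three partial derivatives of u4. *)
Lemma partials_elim (A : comNzRingType) (c1 c2 c3 x y z : A) :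
  let e1 := c1 - 2%:R * x - y * z in
  let e2 := c2 - 2%:R * y - x * z in
  let e3 := c3 - 2%:R * z - x * y in
  (4%:R - z ^+ 2) ^+ 2 * (c3 - 2%:R * z)
    - (2%:R * c1 - c2 * z) * (2%:R * c2 - c1 * z) =
  (4%:R - z ^+ 2) ^+ 2 * e3
  - (2%:R * c2 - c1 * z) * (2%:R * e1 - z * e2)
  - (4%:R - z ^+ 2) * x * (2%:R * e2 - z * e1).
Proof. by move=> e1 e2 e3; rewrite /e1 /e2 /e3; ring. Qed.

Lemma partials_quintic (K : fieldType) (n : nat) (S : {mpoly K[n]} -> Prop)
    (c1 c2 c3 : K) (x y z : {mpoly K[n]}) :
    2%:R != 0 :> K ->
    ideal_gen S (c1%:MP - 2%:R * x - y * z) ->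
    ideal_gen S (c2%:MP - 2%:R * y - x * z) ->
    ideal_gen S (c3%:MP - 2%:R * z - x * y) ->
  exists p : {poly K}, p != 0 /\ ideal_gen S (map_poly (@mpolyC n K) p).[z].
Proof.
move=> nz2 S1 S2 S3.
pose s := [:: 16%:R * c3 - 4%:R * c1 * c2;
              2%:R * c1 ^+ 2 + 2%:R * c2 ^+ 2 - 32%:R;
              - 8%:R * c3 - c1 * c2; 16%:R; c3; - 2%:R].
exists (Poly s); split.
  apply: contra_neq nz2 => s0; have := congr1 (fun p : {poly K} => p`_5) s0.
  by rewrite coef_Poly coef0 /= => /eqP; rewrite oppr_eq0 => /eqP.
rewrite map_Poly horner_Poly /=.
have -> : ((((((0 * z + (- 2%:R)%:MP) * z + c3%:MP) * z + (16%:R)%:MP) * z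
     + (- 8%:R * c3 - c1 * c2)%:MP) * z
     + (2%:R * c1 ^+ 2 + 2%:R * c2 ^+ 2 - 32%:R)%:MP) * z
     + (16%:R * c3 - 4%:R * c1 * c2)%:MP) =
  (4%:R - z ^+ 2) ^+ 2 * (c3%:MP - 2%:R * z)
    - (2%:R * c1%:MP - c2%:MP * z) * (2%:R * c2%:MP - c1%:MP * z) by ring.
rewrite (partials_elim _ _ _ x y); do 2?apply: ideal_genB;
  apply: ideal_genMl => //;
by apply: ideal_genB; apply: ideal_genMl.
Qed.

Lemma rmorph_delta (A B : comNzRingType) (f : {rmorphism A -> B}) (a b c d : A) :
  f (delta a b c d) = delta (f a) (f b) (f c) (f d).
Proof. by rewrite /delta; ring. Qed.

Lemma psi4_meval (K : fieldType) (b : 'I_4 -> K) :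
  let b1 := b (t_ 0) in let b2 := b (t_ 1) in
  let b3 := b (t_ 2) in let b4 := b (t_ 3) in
  (psi4 K).@[b] = delta b1 b2 b3 b4 ^+ 2 *
    ((b1 ^+ 2 - 4%:R) * (b2 ^+ 2 - 4%:R) * (b3 ^+ 2 - 4%:R) * (b4 ^+ 2 - 4%:R)).
Proof.
move=> b1 b2 b3 b4.
have o4 : [/\ ord0 = t_ 0, lift ord0 ord0 = t_ 1,
              lift ord0 (lift ord0 ord0) = t_ 2 &
              lift ord0 (lift ord0 (lift ord0 ord0)) = t_ 3].
  by split; apply: val_inj.
case: o4 => o0 o1 o2 o3.
have sum4 (F : 'I_4 -> {mpoly K[4]}) :
    \sum_i F i = F (t_ 0) + F (t_ 1) + F (t_ 2) + F (t_ 3).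
  by rewrite !big_ord_recl big_ord0 o3 o2 o1 o0 addr0 !addrA.
have prod4 (F : 'I_4 -> {mpoly K[4]}) :
    \prod_i F i = F (t_ 0) * F (t_ 1) * F (t_ 2) * F (t_ 3).
  by rewrite !big_ord_recl big_ord0 o3 o2 o1 o0 mulr1 !mulrA.
have sumif (P : pred 'I_4) (F : 'I_4 -> {mpoly K[4]}) :
    \sum_(i | P i) F i = \sum_i if P i then F i else 0 by rewrite big_mkcond.
rewrite /psi4 mevalM rmorphXn /= prod4 !mevalM.
have factor i : ('X_i ^+ 2 - 4%:R : {mpoly K[4]}).@[b] = b i ^+ 2 - 4%:R.
  by rewrite rmorphB rmorphXn rmorph_nat /= mevalXU.
rewrite !factor; congr (_ ^+ 2 * _).
have -> : Delta K = delta 'X_(t_ 0) 'X_(t_ 1) 'X_(t_ 2) 'X_(t_ 3).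
  rewrite /Delta !prod4 !sum4.
  do 2!rewrite !(sumif (fun j => (_ < nat_of_ord j)%N)) !sum4 /=.
  move: 'X_(t_ 0) 'X_(t_ 1) 'X_(t_ 2) 'X_(t_ 3) => y1 y2 y3 y4.
  by rewrite /delta; ring.
by rewrite rmorph_delta /= !mevalXU.
Qed.

Section JacobianIdeal.
Variable K : closedFieldType.
Hypothesis nz2 : 2%:R != 0 :> K.
Variable b : 'I_4 -> K.

Let b1 := b (t_ 0).
Let b2 := b (t_ 1).
Let b3 := b (t_ 2).
Let b4 := b (t_ 3).

Let I (p : {mpoly K[3]}) : Prop :=
  let phi := fun _ : 'I_1 => u4_at b in gens phi p \/ minors phi 1 p.

Let IE p : I p <-> p = u4_at b \/ exists j, p = (u4_at b)^`M(j).
Proof.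
split=> [[[_ ->]|[f [g ->]]]|[->|[j ->]]]; first by left.
- by right; exists (g ord0); rewrite det_mx11 !mxE.
- by left; exists ord0.
by right; exists (fun=> ord0), (fun=> j); rewrite det_mx11 !mxE.
Qed.

Let zeroP v : (forall p, I p -> p.@[v] = 0) <->
  sing_point b1 b2 b3 b4 (v (x_ 0)) (v (x_ 1)) (v (x_ 2)).
Proof.
have evE (c : K) (p q r : {mpoly K[3]}) :
    (c%:MP - 2%:R * p - q * r).@[v] = c - 2%:R * p.@[v] - q.@[v] * r.@[v].
  by rewrite !mevalB !mevalM mevalC (rmorph_nat (meval v)).
have E0 : ((u4_at b)^`M(x_ 0)).@[v] =
    b1 * b2 + b3 * b4 - 2%:R * v (x_ 0) - v (x_ 1) * v (x_ 2).
  by rewrite mderiv_u4_at0 evE !mevalXU.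
have E1 : ((u4_at b)^`M(x_ 1)).@[v] =
    b1 * b3 + b2 * b4 - 2%:R * v (x_ 1) - v (x_ 0) * v (x_ 2).
  by rewrite mderiv_u4_at1 evE !mevalXU.
have E2 : ((u4_at b)^`M(x_ 2)).@[v] =
    b2 * b3 + b1 * b4 - 2%:R * v (x_ 2) - v (x_ 0) * v (x_ 1).
  by rewrite mderiv_u4_at2 evE !mevalXU.
rewrite /sing_point -E0 -E1 -E2 -u4_at_meval; split=> [I0|[U0 Z0 Z1 Z2] p].
  split; apply: I0; apply/IE; first by left.
  - by right; exists (x_ 0).
  - by right; exists (x_ 1).
  - by right; exists (x_ 2).
move/IE => [->//|[j ->]].
have [-> | [-> | ->]] // : j = x_ 0 \/ (j = x_ 1 \/ j = x_ 2).
by case: j => [[|[|[|//]]] ltj]; [left|right; left|right; right]; apply: val_inj.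
Qed.

Let partials_finite (i : 'I_3) :
  exists p : {poly K}, p != 0 /\ ideal_gen I (map_poly (@mpolyC 3 K) p).['X_i].
Proof.
have I0 : ideal_gen I ((u4_at b)^`M(x_ 0)).
  by apply/ideal_gen_sub/IE; right; exists (x_ 0).
have I1 : ideal_gen I ((u4_at b)^`M(x_ 1)).
  by apply/ideal_gen_sub/IE; right; exists (x_ 1).
have I2 : ideal_gen I ((u4_at b)^`M(x_ 2)).
  by apply/ideal_gen_sub/IE; right; exists (x_ 2).
rewrite mderiv_u4_at0 in I0; rewrite mderiv_u4_at1 in I1.
rewrite mderiv_u4_at2 in I2.
have [-> | [-> | ->]] : i = x_ 0 \/ (i = x_ 1 \/ i = x_ 2).
- by case: i => [[|[|[|//]]] lti]; [left|right; left|right; right]; apply: val_inj.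
- rewrite ['X_(x_ 0) * 'X_(x_ 2)]mulrC in I1.
  rewrite ['X_(x_ 0) * 'X_(x_ 1)]mulrC in I2.
  rewrite ['X_(x_ 1) * 'X_(x_ 2)]mulrC in I0.
  exact: (partials_quintic nz2 I2 I1 I0).
- rewrite ['X_(x_ 1) * 'X_(x_ 2)]mulrC in I0.
  exact: (partials_quintic nz2 I0 I2 I1).
- exact: (partials_quintic nz2 I0 I1 I2).
Qed.

Lemma M_singular_psi4 : M_singular b <-> (psi4 K).@[b] = 0.
Proof.
rewrite psi4_meval -/b1 -/b2 -/b3 -/b4; split=> [sing|].
  apply/eqP; apply: contra_notT sing => psi_neq0 c codim_c p.
  rewrite (has_codim_uniq codim_c (has_codim_u4_at b nz2)).
  apply: ideal_gen_full; apply: (@finite_weak_nullstellensatz K 3 I) => // v.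
  have [Uv|Uv] := eqVneq (u4_at b).@[v] 0; last first.
    by exists (u4_at b); split=> //; apply/IE; left.
  have /existsP[j dUv] : [exists j : 'I_3, ((u4_at b)^`M(j)).@[v] != 0].
    apply: contraNT psi_neq0; rewrite negb_exists => /forallP dU0.
    apply/eqP/(@sing_point_psi _ _ _ _ _ (v (x_ 0)) (v (x_ 1)) (v (x_ 2))).
    apply/zeroP => q /IE [->//|[j ->]]; exact/eqP/negPn.
  by exists ((u4_at b)^`M(j)); split=> //; apply/IE; right; exists j.
move/(psi_sing_point nz2) => [x [y [z S]]] /(_ 1%N (has_codim_u4_at b nz2) 1) I1.
have := oner_neq0 K; rewrite -(meval1 (fun i : 'I_3 => [:: x; y; z]`_i)).
move=> /eqP[]; apply: (ideal_gen_vanish _ I1); exact/zeroP.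
Qed.

End JacobianIdeal.

Theorem mainTheorem2 (R : realType) (b : 'I_4 -> R[i]) :
  M_singular b <-> (psi4 R[i]).@[b] = 0.
Proof.
apply: M_singular_psi4.
by rewrite Num.Theory.pnatr_eq0.
Qed.
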